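(* Let $(X,d,W)$ be a complete $UCW$-hyperbolic space, let $C=\bigcup_{k=1}^{p}C_k$ be a union of nonempty closed convex subsets $C_k$ of $X$ ($p\ge1$ an integer), and let $T:C\to C$ be a nonexpansive mapping having bounded orbits. Then $T$ has periodic points.
   Context: A $W$-hyperbolic space $(X,d,W)$ is a metric space $(X,d)$ together with a map $W:X\times X\times[0,1]\to X$ (a convexity mapping) such that for all $x,y,z,w\in X$ and $\lambda,\tilde\lambda\in[0,1]$: (W1) $d(z,W(x,y,\lambda))\le(1-\lambda)d(z,x)+\lambda d(z,y)$; (W2) $d(W(x,y,\lambda),W(x,y,\tilde\lambda))=|\lambda-\tilde\lambda|\,d(x,y)$; (W3) $W(x,y,\lambda)=W(y,x,1-\lambda)$; (W4) $d(W(x,z,\lambda),W(y,w,\lambda))\le(1-\lambda)d(x,y)+\lambda d(z,w)$. One writes $(1-\lambda)x\oplus\lambda y:=W(x,y,\lambda)$. A subset $C\subseteq X$ is convex if $W(x,y,\lambda)\in C$ for all $x,y\in C$, $\lambda\in[0,1]$. A modulus of uniform convexity for $(X,d,W)$ is a map $\eta:(0,\infty)\times(0,2]\to(0,1]$ such that for all $r>0$, $\varepsilon\in(0,2]$ and $a,x,y\in X$: if $d(x,a)\le r$, $d(y,a)\le r$ and $d(x,y)\ge\varepsilon r$, then $d(\frac12x\oplus\frac12y,a)\le(1-\eta(r,\varepsilon))r$. It is monotone if it decreases (is nonincreasing) in $r$ for each fixed $\varepsilon$. A $UCW$-hyperbolic space is a $W$-hyperbolic space admitting a monotone modulus of uniform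 convexity; it is complete if the metric space $(X,d)$ is complete. $T:C\to C$ is nonexpansive if $d(Tx,Ty)\le d(x,y)$ for all $x,y\in C$. The orbit of $x\in C$ is $\{T^nx\mid n=0,1,2,\ldots\}$; a nonexpansive $T$ has bounded orbits if the orbit of some (equivalently, every) $x\in C$ is bounded. A periodic point of $T$ is a point $x\in C$ with $T^nx=x$ for some integer $n\ge1$. *)

(* Defs.v *)
From HB Require Import structures.
From mathcomp Require Import all_boot all_order all_algebra.
From mathcomp Require Import all_classical all_reals all_analysis.

Set Implicit Arguments.
Unset Strict Implicit.
Unset Printing Implicit Defensive.

Import Order.TTheory GRing.Theory Num.Theory.
Import numFieldTopology.Exports.

Local Open Scope classical_set_scope.
Local Open Scope ring_scope.

Section Defs.
Context {R : realType} {X : metricType R}.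
Local Notation d := (@mdist R X).

Definition complete_metric : Prop :=
  forall u : nat -> X, cauchy (u @ \oo) -> exists l : X, u @ \oo --> l.

Definition metric_bounded (A : set X) : Prop :=
  exists M : R, forall x y, A x -> A y -> d x y <= M.

(* [W x y l] stands for (1 - l) x (+) l y; its values for l outside [0, 1] are
   unconstrained and never used. *)
Record W_hyperbolic (W : X -> X -> R -> X) : Prop := {
  W1 : forall x y z l, 0 <= l <= 1 ->
    d z (W x y l) <= (1 - l) * d z x + l * d z y;
  W2 : forall x y l l', 0 <= l <= 1 -> 0 <= l' <= 1 ->
    d (W x y l) (W x y l') = `|l - l'| * d x y;
  W3 : forall x y l, 0 <= l <= 1 -> W x y l = W y x (1 - l);
  W4 : forall x y z w l, 0 <= l <= 1 ->
    d (W x z l) (W y w l) <= (1 - l) * d x y + l * d z w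
}.

Definition W_convex (W : X -> X -> R -> X) (A : set X) : Prop :=
  forall x y l, A x -> A y -> 0 <= l <= 1 -> A (W x y l).

(* [eta] is a map (0, oo) x (0, 2] -> (0, 1], extended arbitrarily. *)
Definition modulus_of_uniform_convexity
    (W : X -> X -> R -> X) (eta : R -> R -> R) : Prop :=
  (forall r e, 0 < r -> 0 < e <= 2 -> 0 < eta r e <= 1) /\
  (forall r e a x y, 0 < r -> 0 < e <= 2 ->
    d x a <= r -> d y a <= r -> e * r <= d x y ->
    d (W x y 2^-1) a <= (1 - eta r e) * r).

Definition monotone_modulus (eta : R -> R -> R) : Prop :=
  forall r s e, 0 < r -> r <= s -> 0 < e <= 2 -> eta s e <= eta r e.

Definition UCW_hyperbolic (W : X -> X -> R -> X) : Prop :=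
  W_hyperbolic W /\
  exists eta, modulus_of_uniform_convexity W eta /\ monotone_modulus eta.

(* A self-map of a subset [C] is a total function [T : X -> X] together with
   [set_fun C C T]; the notions below only involve its values on [C]. *)
Definition nonexpansive_on (C : set X) (T : X -> X) : Prop :=
  forall x y, C x -> C y -> d (T x) (T y) <= d x y.

Definition forward_orbit (T : X -> X) (x : X) : set X :=
  range (fun n : nat => iter n T x).

Definition has_bounded_orbits (C : set X) (T : X -> X) : Prop :=
  exists2 x, C x & metric_bounded (forward_orbit T x).

Definition periodic_point (C : set X) (T : X -> X) (x : X) : Prop :=
  C x /\ exists2 n : nat, (1 <= n)%N & iter n T x = x.

End Defs.

Arguments complete_metric {R} X.

(* Main.v *)
(** The asymptotic radius of a point [y] with respect to an orbit [(T^n x)] is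
    [limsup_n d (T^n x) y].  Uniform convexity gives it exactly one minimizer on
    each closed convex piece [Ck k], so it has a finite nonempty set of minimizers
    on [C].  Nonexpansiveness makes [T] map this set into itself, and the
    pigeonhole principle yields a periodic point. *)
Require Import Defs.
From HB Require Import structures.
From mathcomp Require Import all_boot all_order all_algebra.
From mathcomp Require Import all_classical all_reals all_analysis.
From mathcomp Require Import lra.

Import Order.TTheory GRing.Theory Num.Theory.

Local Open Scope classical_set_scope.
Local Open Scope ring_scope.

Section AsymptoticRadius.
Context {R : realType} {X : metricType R}.
Implicit Types (u : nat -> X) (y z : X) (s : R) (D : set X).

Definition eventual_bounds u y : set R :=
  [set s | \forall n \near \oo, mdist (u n) y <= s].

(* The infimum of eventual upper bounds of [d (u n) y] is its limsup. *)
Definition asymp_radius u y : R := inf (eventual_bounds u y).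

Lemma eventual_bounds_ge0 u y s : eventual_bounds u y s -> 0 <= s.
Proof.
case=> N _ /(_ N (leqnn N)) /=; apply: le_trans; exact: mdist_ge0.
Qed.

Lemma has_lbound_eventual_bounds u y : has_lbound (eventual_bounds u y).
Proof. by exists 0 => s; exact: eventual_bounds_ge0. Qed.

Lemma asymp_radius_le {u y s} : eventual_bounds u y s -> asymp_radius u y <= s.
Proof. by move=> us; apply: ge_inf => //; exact: has_lbound_eventual_bounds. Qed.

Section Bounded.
Context {u : nat -> X} (ubd : metric_bounded (range u)).

(** Boundedness of [u] rules out the empty set, whose [inf] would be the default value 0. *)
Lemma eventual_bounds_nonempty y : eventual_bounds u y !=set0.
Proof.
have [M uM] := ubd; exists (M + mdist (u 0%N) y); apply: nearW => n.
apply: le_trans (metric_triangle _ (u 0%N) _) _.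
by rewrite lerD2r; apply: uM; [exists n | exists 0%N].
Qed.

Lemma asymp_radius_ge0 y : 0 <= asymp_radius u y.
Proof.
by apply: lb_le_inf (eventual_bounds_nonempty y) _ => s /eventual_bounds_ge0.
Qed.

Lemma asymp_radius_lt {y s} : asymp_radius u y < s -> eventual_bounds u y s.
Proof.
move=> /(inf_lt (eventual_bounds_nonempty y))[t ut /ltW ts].
by apply: filterS ut => n /le_trans; exact.
Qed.

Lemma asymp_radius_lipschitz y z :
  asymp_radius u y <= asymp_radius u z + mdist z y.
Proof.
apply/ler_addgt0Pl => e e0.
have /asymp_radius_lt uz : asymp_radius u z < asymp_radius u z + e.
  by rewrite ltrDl.
apply: asymp_radius_le; apply: filterS uz => n uz.
apply: le_trans (metric_triangle _ z _) _.
by rewrite addrA lerD2r addrC.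
Qed.

Lemma asymp_radius_separation y z :
  mdist y z <= asymp_radius u y + asymp_radius u z.
Proof.
apply/ler_addgt0Pl => e e0; have e2 : 0 < e / 2 by rewrite divr_gt0.
have /asymp_radius_lt uy : asymp_radius u y < asymp_radius u y + e / 2.
  by rewrite ltrDl.
have /asymp_radius_lt uz : asymp_radius u z < asymp_radius u z + e / 2.
  by rewrite ltrDl.
have [N _ /(_ N (leqnn N)) [/= h1 h2]] := filterI uy uz.
have := metric_triangle y (u N) z; rewrite (metric_sym y (u N)); lra.
Qed.

(** If two near-minimizers were [e] apart, uniform convexity around the late terms of [u] would push
    the radius of their midpoint below [m]. This quantitative form serves both existence and
    uniqueness of the center. *)
Lemma asymp_radius_near_min W D m e : UCW_hyperbolic W -> W_convex W D ->
  0 <= m -> (forall y, D y -> m <= asymp_radius u y) -> 0 < e ->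
  exists2 del, 0 < del & forall y z, D y -> D z ->
    asymp_radius u y < m + del -> asymp_radius u z < m + del -> mdist y z < e.
Proof.
move=> [_ [eta [[eta01 etaP] etam]]] convD m0 mD e0.
(* For [m = 0] convexity gains nothing, but two points of small radius are close to a common term of
   [u]. *)
have [->{m0 mD m}|mN0] := eqVneq m 0.
  exists (e / 2); first by rewrite divr_gt0.
  by move=> y z _ _; have := asymp_radius_separation y z; lra.
have {mN0}m0 : 0 < m by rewrite lt_neqAle eq_sym mN0.
(* The radius [m + del] used below is at most [m + 1], so [e1 * (m + del) <= e]; the cap 2 keeps
   [e1] in the domain of [eta]. *)
pose e1 := Num.min 2 (e / (m + 1)).
have m1 : 0 < m + 1 by lra.
have e12 : 0 < e1 <= 2.
  by rewrite lt_min ge_min lexx /= andbT ltr0n /= divr_gt0.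
have e1e : e1 * (m + 1) <= e.
  by rewrite -ler_pdivlMr// ge_min lexx orbT.
have /andP[h0 h1] := eta01 (m + 1) e1 m1 e12.
set h := eta (m + 1) e1 in h0 h1.
(* Chosen so that [(1 - h) * (m + del) <= m - h * m / 2 - h * del < m]. *)
pose del := Num.min 1 (h * m / 2).
have hm : 0 < h * m by rewrite mulr_gt0.
have del0 : 0 < del by rewrite lt_min ltr01 /= divr_gt0.
have del1 : del <= 1 by rewrite ge_min lexx.
have delh : del <= h * m / 2 by rewrite ge_min lexx orbT.
exists del => // y z Dy Dz uy uz; rewrite ltNge; apply/negP => eyz.
have s0 : 0 < m + del by lra.
have /mD : D (W y z 2^-1) by apply: convD => //; lra.
apply/negP; rewrite -ltNge.
apply: (@le_lt_trans _ _ ((1 - h) * (m + del))); last by nra.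
apply: asymp_radius_le.
apply: filterS2 (asymp_radius_lt uy) (asymp_radius_lt uz) => n uny unz.
rewrite metric_sym.
apply: (@le_trans _ _ ((1 - eta (m + del) e1) * (m + del))).
  apply: etaP => //; [by rewrite metric_sym | by rewrite metric_sym |].
  by apply: le_trans eyz; apply: le_trans e1e; rewrite ler_wpM2l; lra.
(* Monotonicity gives [h <= eta (m + del) e1], which lets [h] be fixed before [del]. *)
rewrite ler_wpM2r ?(ltW s0)// lerD2l lerN2; apply: etam => //; lra.
Qed.

(** A minimizing sequence is Cauchy because near-minimizers cluster; the Lipschitz bound carries
    minimality to its limit. *)
Lemma asymp_center_exists W D : UCW_hyperbolic W -> complete_metric X ->
  D !=set0 -> closed D -> W_convex W D ->
  exists2 c, D c & forall y, D y -> asymp_radius u c <= asymp_radius u y.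
Proof.
move=> hW hX [y0 Dy0] clD convD.
pose A := [set asymp_radius u y | y in D]; pose m := inf A.
have A0 : A !=set0 by exists (asymp_radius u y0), y0.
have lbA : has_lbound A by exists 0 => _ [y _ <-]; exact: asymp_radius_ge0.
have mD y : D y -> m <= asymp_radius u y by move=> Dy; apply: ge_inf => //; exists y.
have m0 : 0 <= m by apply: lb_le_inf => // _ [y _ <-]; exact: asymp_radius_ge0.
have /choice[v vP] (n : nat) :
    exists y, D y /\ asymp_radius u y < m + n.+1%:R^-1.
  have /(inf_lt A0)[_ [y Dy <-]] : m < m + n.+1%:R^-1.
    by rewrite ltrDl invr_gt0.
  by exists y.
have vsmall e : 0 < e -> \forall n \near \oo, asymp_radius u (v n) < m + e.
  move=> e0; apply: filterS (near_infty_natSinv_lt (PosNum e0)) => n /= ne.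
  by apply: lt_trans (vP n).2 _; rewrite ltrD2l.
have /hX[c vc] : cauchy (v @ \oo).
  apply: cauchy_exP => e e0.
  have [del del0 delP] := asymp_radius_near_min _ _ _ _ hW convD m0 mD e0.
  have [N _ vN] := vsmall _ del0.
  exists (v N); exists N => // n /= Nn; rewrite ballEmdist /=.
  by apply: delP; [exact: (vP _).1|exact: (vP _).1|exact: vN (leqnn N)|exact: vN].
exists c; first by apply: closed_cvg vc => //; apply: nearW => n; exact: (vP n).1.
move=> y /mD; apply: le_trans; apply/ler_addgt0Pl => e e0.
have e2 : 0 < e / 2 by rewrite divr_gt0.
have /cvg_ballP/(_ _ e2) vce := vc.
have [N _ /(_ N (leqnn N)) [/= h1]] := filterI (vsmall _ e2) vce.
rewrite ballEmdist /= metric_sym => h2.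
by have := asymp_radius_lipschitz c (v N); lra.
Qed.

Lemma asymp_center_unique W D y z : UCW_hyperbolic W -> W_convex W D ->
  D y -> D z -> asymp_radius u y = asymp_radius u z ->
  (forall x, D x -> asymp_radius u y <= asymp_radius u x) -> y = z.
Proof.
move=> hW convD Dy Dz yz ymin; apply/eqP/negPn; rewrite -mdist_gt0.
apply/negP => /(asymp_radius_near_min _ _ _ _ hW convD (asymp_radius_ge0 y) ymin).
move=> [del del0 /(_ y z Dy Dz)].
by rewrite -yz ltrDl del0 ltxx => /(_ isT isT).
Qed.

End Bounded.

Lemma asymp_radius_orbit (C : set X) (T : X -> X) x y :
  set_fun C C T -> nonexpansive_on C T -> C x -> C y ->
  metric_bounded (forward_orbit T x) ->
  asymp_radius (fun n => iter n T x) (T y) <=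
  asymp_radius (fun n => iter n T x) y.
Proof.
move=> TC Tne Cx Cy bd; apply/ler_addgt0Pl => e e0.
have Cit n : C (iter n T x) by elim: n => //= n; exact: TC.
have /(asymp_radius_lt bd)[N _ Ny] : asymp_radius (fun n => iter n T x) y <
    e + asymp_radius (fun n => iter n T x) y by rewrite ltrDr.
(* The term of index [n.+1] near [T y] is controlled by the term of index [n] near [y], hence the
   shift of [N]. *)
apply: asymp_radius_le; exists N.+1 => // -[//|n] /= Nn.
by apply: le_trans (Tne _ _ (Cit n) Cy) _; exact: Ny.
Qed.

End AsymptoticRadius.

Theorem proposition4p5 (R : realType) (X : metricType R) (W : X -> X -> R -> X)
  (hW : UCW_hyperbolic W) (hX : complete_metric X)
  (p : nat) (hp : (1 <= p)%N) (Ck : 'I_p -> set X)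
  (Ck_nonempty : forall k, Ck k !=set0)
  (Ck_closed : forall k, closed (Ck k))
  (Ck_convex : forall k, W_convex W (Ck k))
  (C : set X) (hC : C = \bigcup_(k in [set: 'I_p]) Ck k)
  (T : X -> X) (hT : set_fun C C T)
  (T_nonexpansive : nonexpansive_on C T)
  (T_bounded_orbits : has_bounded_orbits C T) :
  exists x : X, periodic_point C T x.
Proof.
have [x Cx bd] := T_bounded_orbits.
pose rad := asymp_radius (fun n => iter n T x).
have /choice[c cP] k : exists c, Ck k c /\ forall y, Ck k y -> rad c <= rad y.
  have [c Dc cmin] := asymp_center_exists bd W (Ck k) hW hX (Ck_nonempty k)
    (Ck_closed k) (Ck_convex k).
  by exists c.
(* The best of the [p] centers minimizes [rad] on all of [C]; [Ordinal hp] only witnesses that there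
   is an index. *)
pose k0 := [arg min_(k < Ordinal hp) rad (c k)]%O.
have radC y : C y -> rad (c k0) <= rad y.
  rewrite hC => -[k _ ky]; apply: le_trans ((cP k).2 _ ky).
  by rewrite /k0; case: arg_minP => // i _; apply.
pose z n := iter n T (c k0).
have Cz n : C (z n).
  elim: n => [|n]; last exact: hT.
  by rewrite hC; exists k0 => //; exact: (cP k0).1.
have radz n : rad (z n) = rad (c k0).
  apply/eqP; rewrite eq_le radC// andbT.
  elim: n => [//|n]; apply: le_trans.
  by apply: asymp_radius_orbit T_nonexpansive Cx (Cz n) bd.
have /choice[f fP] n : exists k, Ck k (z n).
  by have := Cz n; rewrite hC => -[k _ zk]; exists k.
(* Among the first [p.+1] iterates, two lie in the same piece; both minimize [rad] there, so they
   coincide. *)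
have [i [j [ij fij]]] : exists i j : nat, (i < j)%N /\ f i = f j.
  apply: contrapT => nij.
  have /leq_card : injective (fun i : 'I_p.+1 => f i).
    move=> i j fij; apply/val_inj; apply: contrapT => /eqP.
    by rewrite neq_ltn => /orP[] ij; apply: nij; [exists i, j | exists j, i].
  by rewrite !card_ord ltnn.
have zij : z i = z j.
  apply: (asymp_center_unique bd W (Ck (f i)) _ _ hW) => //.
  - by rewrite fij.
  - by rewrite -!/(rad _) !radz.
  - move=> y fy; rewrite -!/(rad _) radz; apply: radC.
    by rewrite hC; exists (f i).
exists (z i); split => //; exists (j - i)%N; first by rewrite subn_gt0.
by rewrite /z -iterD subnK ?(ltnW ij)// -/(z j) -zij.
Qed.
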